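(* There exist a hereditary graph class $\mathcal C$ of bounded tree-independence number and a constant $c>0$ such that, for infinitely many $n$, some $n$-vertex graph $G\in\mathcal C$ has the property that every clique-based separator of $G$ contains at least $c\sqrt{n/\log n}$ cliques.
   Context: All graphs are finite, simple and nonempty; $\log$ is base 2. A graph class is hereditary if it is closed under taking induced subgraphs. The tree-independence number of $G$ is the minimum over all tree decompositions of $G$ of the maximum of the independence number $\alpha(G[X])$ over all bags $X$; a class has bounded tree-independence number if some constant bounds this parameter for all its graphs. A balanced separator of $G$ is a set $S\subseteq V(G)$ such that every connected component of $G-S$ has at most $2|V(G)|/3$ vertices. A clique-based separator of $G$ is a collection of vertex-disjoint cliques of $G$ whose union is a balanced separator of $G$. *)

(* Defs.v *)
(* MathComp world, with MathComp-Analysis for real numbers and logarithms. *)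
From mathcomp Require Import all_boot all_order all_algebra.
From mathcomp Require Import boolp reals exp.

Set Implicit Arguments.
Unset Strict Implicit.
Unset Printing Implicit Defensive.

Record sgraph : Type := SGraph {
  vertex :> finType;
  adj : rel vertex;
  adj_sym : symmetric adj;
  adj_irr : irreflexive adj;
  vertex_nonempty : 0 < #|vertex| }.

Section Graph.
Variable G : sgraph.
Implicit Types A S X : {set G}.

(* The edge relation of the induced subgraph G[A], kept on the vertices of G;
   this way A may be empty. *)
Definition adj_in A : rel G := [rel x y | [&& x \in A, y \in A & adj x y]].

Definition connected_in A : Prop := {in A &, forall x y, connect (adj_in A) x y}.

Definition components A : {set {set G}} :=
  equivalence_partition (connect (adj_in A)) A.

Definition independent S : bool := [forall x in S, forall y in S, ~~ adj x y].

Definition clique S : bool :=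
  (S != set0) && [forall x in S, forall y in S, (x != y) ==> adj x y].

(* alpha X is the independence number of G[X]. *)
Definition alpha X : nat :=
  \max_(S : {set G} | (S \subset X) && independent S) #|S|.

(* [ucycle] also accepts the degenerate cycles [::] and [:: x; y]. *)
Definition acyclic : Prop :=
  forall c : seq G, ucycle (@adj G) c -> size c <= 2.

Definition is_tree : Prop := connected_in [set: G] /\ acyclic.

(* #|C| <= 2 #|G| / 3, cleared of denominators. *)
Definition balanced_separator S : Prop :=
  forall C, C \in components (~: S) -> 3 * #|C| <= 2 * #|G|.

Definition clique_based_separator (K : {set {set G}}) : Prop :=
  [/\ {in K, forall Q, clique Q}, trivIset K & balanced_separator (cover K)].

End Graph.

Record tree_decomposition (G : sgraph) : Type := TreeDecomposition {
  td_tree : sgraph;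
  td_treeP : is_tree td_tree;
  bag : td_tree -> {set G};
  bag_vertex : forall v : G, exists t, v \in bag t;
  bag_edge : forall u v : G, adj u v -> exists t, (u \in bag t) && (v \in bag t);
  bag_connected : forall v : G, connected_in [set t | v \in bag t] }.

Definition td_alpha (G : sgraph) (D : tree_decomposition G) : nat :=
  \max_(t : td_tree D) alpha (bag t).

Section TrivialDecomposition.
Variable G : sgraph.

Lemma unit_adj_sym : symmetric (fun _ _ : unit => false).
Proof. by []. Qed.

Lemma unit_adj_irr : irreflexive (fun _ : unit => fun _ : unit => false).
Proof. by []. Qed.

Lemma unit_nonempty : 0 < #|{: unit}|.
Proof. by rewrite card_unit. Qed.

Definition unit_graph : sgraph :=
  SGraph unit_adj_sym unit_adj_irr unit_nonempty.

Lemma unit_connected_in (A : {set unit_graph}) : connected_in A.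
Proof. by move=> [] [] _ _; apply: connect0. Qed.

Lemma unit_graph_tree : is_tree unit_graph.
Proof.
split; first exact: unit_connected_in.
by move=> c /andP[_ /card_uniqP <-]; apply: leq_trans (max_card _) _; rewrite card_unit.
Qed.

Lemma exists_td_alpha :
  exists k, `[< exists D : tree_decomposition G, td_alpha D = k >].
Proof.
have bv (v : G) : exists t : unit_graph, v \in [set: G] by exists tt; rewrite inE.
have be (u v : G) : adj u v ->
    exists t : unit_graph, (u \in [set: G]) && (v \in [set: G]).
  by move=> _; exists tt; rewrite !inE.
pose D := @TreeDecomposition G unit_graph unit_graph_tree (fun _ => [set: G])
  bv be (fun v => @unit_connected_in _).
by exists (td_alpha D); apply/asboolP; exists D.
Qed.

End TrivialDecomposition.

Definition tree_independence_number (G : sgraph) : nat :=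
  ex_minn (exists_td_alpha G).

(* H is isomorphic to an induced subgraph of G. *)
Definition induced_subgraph (H G : sgraph) : Prop :=
  exists2 f : H -> G, injective f & forall x y, adj (f x) (f y) = adj x y.

(* Working up to isomorphism makes hereditary classes isomorphism-closed. *)
Definition hereditary (C : sgraph -> Prop) : Prop :=
  forall G H, C G -> induced_subgraph H G -> C H.

Definition bounded_tree_independence_number (C : sgraph -> Prop) : Prop :=
  exists b : nat, forall G, C G -> tree_independence_number G <= b.

Definition log2 (R : realType) (x : R) : R := (ln x / ln 2)%R.

(* Main.v *)
Require Import Defs.
From mathcomp Require Import all_boot all_order all_algebra.
From mathcomp Require Import boolp reals exp.
From mathcomp Require Import zify.

Set Implicit Arguments.
Unset Strict Implicit.
Unset Printing Implicit Defensive.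

(** The class consists of the graphs without six pairwise nonadjacent vertices:
    it is hereditary, and a single bag containing all vertices shows that its
    tree-independence number is at most 5.  Inside the class, randomness gives
    graphs all of whose cliques are small: [ramsey_graph_sqrt] finds, for
    arbitrarily large w, such a graph on 64 w^2 vertices whose cliques have at
    most w vertices.

    In such a graph every balanced separator S covers a positive fraction of
    the n vertices ([clique_separator_lower_bound]).  Suppose |S| < n/6.  What
    remains has at most 5 components, since picking a vertex in each gives an
    independent set; hence some component C has more than n/6 vertices.  By
    balance C has at most 2n/3 vertices, so the rest of the graph outside S also
    has more than n/6.  Each of these two sets is too large to have
    independence number at most 2, because with cliques of size at most w this
    would force at most w(w+1) vertices ([independent_triple]).  An independent
    triple on each side, with no edge across, makes an independent set of
    size 6, a contradiction.  Therefore |S| >= n/6, and covering S takes at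
    least n/(6w) cliques, which exceeds sqrt n = 8w.  This is more than the
    required sqrt (n / log n), so c = 1 works.

    The random graph joins each pair of vertices independently with probability
    1 - 1/q.  Probability is replaced by counting colourings of the vertex
    pairs with q colours, one of which means nonadjacent.  An independent
    6-set fixes 15 pairs, so it is avoidable as soon as 2 n^6 < q^15, which
    allows q to be a power of n with exponent below 1/2; cliques then have at
    most about q log n vertices, fewer than sqrt n / 8.  The size 6 suits both
    parts of the argument: it splits as 3 + 3, and the exponent 2/5 in
    q ~ n^(2/5) is below the 1/2 demanded by [independent_triple]. *)

Import Order.TTheory GRing.Theory Num.Theory.

Local Open Scope nat_scope.

(** * Independent sets, cliques and the graph class *)

Lemma independentP (G : sgraph) (S : {set G}) :
  reflect {in S &, forall x y, ~~ adj x y} (independent S).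
Proof.
apply: (iffP forall_inP) => [h x y xS yS|h x xS]; first exact: (forall_inP (h x xS)).
by apply/forall_inP => y yS; apply: h.
Qed.

Lemma cliqueP (G : sgraph) (S : {set G}) :
  reflect (S != set0 /\ {in S &, forall x y, x != y -> adj x y}) (clique S).
Proof.
apply: (iffP andP) => -[-> h]; split=> //.
  by move=> x y xS yS; apply/implyP; apply: (forall_inP (forall_inP h x xS)).
by apply/forall_inP => x xS; apply/forall_inP => y yS; apply/implyP; apply: h.
Qed.

Lemma independentU (G : sgraph) (S T : {set G}) :
  independent S -> independent T -> {in S & T, forall x y, ~~ adj x y} ->
  independent (S :|: T).
Proof.
move=> /independentP iS /independentP iT iST; apply/independentP => x y.
rewrite !inE => /orP[xS|xT] /orP[yS|yT]; [exact: iS|exact: iST| |exact: iT].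
by rewrite adj_sym; apply: iST.
Qed.

Lemma independent_card_alpha (G : sgraph) (S : {set G}) :
  independent S -> #|S| <= alpha [set: G].
Proof. by move=> iS; apply: leq_bigmax_cond; rewrite subsetT. Qed.

Lemma subset_of_card (T : finType) (A : {set T}) k :
  k <= #|A| -> exists2 B : {set T}, B \subset A & #|B| = k.
Proof.
rewrite -bin_gt0 -cards_draws => /card_gt0P[B].
by rewrite inE => /andP[sBA /eqP]; exists B.
Qed.

Lemma leq_card_bigcup (I T : finType) (P : pred I) (F : I -> {set T}) :
  #|\bigcup_(i | P i) F i| <= \sum_(i | P i) #|F i|.
Proof.
elim/big_rec2: _ => [|i m B _ IH]; first by rewrite cards0.
by apply: leq_trans (leq_card_setU _ _) _; rewrite leq_add2l.
Qed.

(** The decomposition whose tree is one vertex and whose only bag is the whole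
    vertex set is the witness. *)
Lemma tree_independence_number_le (G : sgraph) :
  tree_independence_number G <= alpha [set: G].
Proof.
have bv (v : G) : exists t : unit_graph, v \in [set: G] by exists tt; rewrite inE.
have be (u v : G) : adj u v ->
    exists t : unit_graph, (u \in [set: G]) && (v \in [set: G]).
  by move=> _; exists tt; rewrite !inE.
pose D := @TreeDecomposition G unit_graph unit_graph_tree (fun _ => [set: G])
  bv be (fun v => @unit_connected_in _).
rewrite /tree_independence_number; case: ex_minnP => k _ /(_ (td_alpha D)) le_k.
apply: leq_trans (le_k _) _; first by apply/asboolP; exists D.
by apply/bigmax_leqP.
Qed.

Lemma hereditary_alpha b : hereditary (fun G : sgraph => alpha [set: G] <= b).
Proof.
move=> G H leG [f f_inj f_adj]; apply/bigmax_leqP => S /andP[_ /independentP iS].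
rewrite -(card_imset _ f_inj); apply: leq_trans leG.
apply: independent_card_alpha; apply/independentP.
move=> _ _ /imsetP[x xS ->] /imsetP[y yS ->].
by rewrite f_adj; apply: iS.
Qed.

(** * Balanced separators of graphs with small cliques *)

(** A quantitative form of Ramsey's theorem for independent triples.  Take a
    maximum clique M of A: each vertex of A is a non-neighbour of some vertex
    of M.  If there is no independent triple, the non-neighbours of a vertex
    form a clique, so the at most w vertices of M account for at most
    w (w + 1) vertices of A. *)
Lemma independent_triple (G : sgraph) w (A : {set G}) :
  (forall Q : {set G}, clique Q -> #|Q| <= w) -> w * w.+1 < #|A| ->
  exists T : {set G}, [/\ T \subset A, independent T & #|T| = 3].
Proof.
move=> omega_w ltA; apply: contrapT => noT.
have /card_gt0P[x0 x0A] : 0 < #|A| by apply: leq_ltn_trans ltA.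
pose PQ (Q : {set G}) := clique Q && (Q \subset A).
have PQ0 : PQ [set x0].
  rewrite /PQ sub1set x0A andbT; apply/cliqueP; split.
    by apply/set0Pn; exists x0; rewrite inE.
  by move=> x y /set1P-> /set1P->; rewrite eqxx.
case: (arg_maxnP (fun Q : {set G} => #|Q|) PQ0) => M /andP[/cliqueP[M0 cM] sMA] maxM.
(* As adjacency is irreflexive, m itself lies in N m: hence the bound w + 1,
   and hence the sets N m cover M as well. *)
pose N m := [set v in A | ~~ adj m v].
have leN m : m \in M -> #|N m| <= w.+1.
  move=> mM; have mA := subsetP sMA m mM.
  have mN : m \in N m by rewrite !inE mA adj_irr.
  rewrite (cardsD1 m) mN add1n ltnS.
  have [->|nz] := eqVneq (N m :\ m) set0; first by rewrite cards0.
  apply: omega_w; apply/cliqueP; split=> // x y.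
  rewrite !inE => /and3P[xm xA mx] /and3P[ym yA my] xy.
  apply: contrapT => /negP nxy; apply: noT; exists [set m; x; y]; split.
  - by apply/subsetP => z; rewrite !inE => /orP[/orP[]|] /eqP->.
  - apply/independentP => u v; rewrite !inE.
    by move=> /orP[/orP[]|] /eqP-> /orP[/orP[]|] /eqP->;
       rewrite ?adj_irr // adj_sym.
  - by rewrite setUC cardsU1 !inE cards2 negb_or ym (eq_sym m) xm eq_sym xy.
have sAN : A \subset \bigcup_(m in M) N m.
  apply/subsetP => v vA; apply/bigcupP; apply: contrapT => noM.
  have adjM m : m \in M -> adj m v.
    move=> mM; apply: contrapT => /negP nmv; apply: noM.
    by exists m => //; rewrite inE vA.
  have vM : v \notin M by apply/negP => /adjM; rewrite adj_irr.
  have PvM : PQ (v |: M).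
    rewrite /PQ subUset sub1set vA sMA !andbT; apply/cliqueP; split.
      by apply/set0Pn; exists v; rewrite setU11.
    move=> x y /setU1P[->|xM] /setU1P[->|yM] //; first by rewrite eqxx.
    - by move=> _; rewrite adj_sym; apply: adjM.
    - by move=> _; apply: adjM.
    - exact: cM.
  by have := maxM _ PvM; rewrite /= cardsU1 vM add1n ltnn.
have leM : #|M| <= w by apply: (omega_w M); apply/cliqueP.
move: ltA; rewrite ltnNge => /negP; apply.
apply: leq_trans (subset_leq_card sAN) _.
apply: leq_trans (leq_card_bigcup _ N) _.
apply: (@leq_trans (\sum_(m in M) w.+1)); first exact: leq_sum.
by rewrite sum_nat_const leq_mul2r leM orbT.
Qed.

Lemma connect_adj_in_equivalence (G : sgraph) (A : {set G}) :
  {in A & &, equivalence_rel (connect (adj_in A))}.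
Proof.
move=> x y z _ _ _; split=> // xy.
have sym_adj : symmetric (adj_in A) by move=> u v; rewrite /adj_in /= andbCA adj_sym.
exact: (same_connect (sym_connect_sym sym_adj) xy).
Qed.

Lemma components_partition (G : sgraph) (A : {set G}) : partition (components A) A.
Proof. exact: equivalence_partitionP (@connect_adj_in_equivalence G A). Qed.

Lemma adj_pblock_components (G : sgraph) (A : {set G}) x y :
  x \in A -> y \in A -> adj x y ->
  pblock (components A) x = pblock (components A) y.
Proof.
move=> xA yA xy; have [/eqP covA tiA _] := and3P (components_partition A).
apply/eqP; rewrite eq_pblock ?covA //.
rewrite (pblock_equivalence_partition (@connect_adj_in_equivalence G A)) //.
by apply: connect1; rewrite /adj_in /= xA yA.
Qed.

(** Vertices taken from distinct components are nonadjacent, so a transversal of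
    the components is an independent set. *)
Lemma card_components_le (G : sgraph) (A : {set G}) : #|components A| <= alpha [set: G].
Proof.
have trX := transversalP (components_partition A).
rewrite -(card_transversal trX); apply: independent_card_alpha.
have sXA := subsetP (transversal_sub trX).
apply/independentP => x y xX yX; apply/negP => xy.
have := adj_pblock_components (sXA x xX) (sXA y yX) xy.
by move/(pblock_inj trX xX yX) => eq_xy; rewrite eq_xy adj_irr in xy.
Qed.

Lemma component_closed (G : sgraph) (A C : {set G}) :
  C \in components A -> {in C & A :\: C, forall x y, ~~ adj x y}.
Proof.
move=> CA x y xC /setDP[yA yC]; apply/negP => xy.
have [/eqP covA tiA _] := and3P (components_partition A).
have xA : x \in A by rewrite -covA; apply/bigcupP; exists C.
move: yC; rewrite -(def_pblock tiA CA xC) (adj_pblock_components xA yA xy).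
by rewrite mem_pblock covA yA.
Qed.

(** The separator must contain a sixth of the vertices: otherwise what it leaves
    splits into two anticomplete parts, each with more than a sixth of the
    vertices and therefore with an independent triple, and the two triples
    together exceed the independence number. *)
Lemma clique_separator_lower_bound (G : sgraph) w (K : {set {set G}}) :
  alpha [set: G] <= 5 -> (forall Q : {set G}, clique Q -> #|Q| <= w) ->
  6 * (w * w.+1) < #|G| -> clique_based_separator K -> #|G| <= 6 * (w * #|K|).
Proof.
move=> alpha5 omega_w ltG [cK _ sepK].
have le_cover : #|cover K| <= w * #|K|.
  apply: leq_trans (leq_card_cover K) _; rewrite mulnC -sum_nat_const.
  by apply: leq_sum => Q /cK; apply: omega_w.
rewrite leqNgt; apply/negP => ltK.
set A := ~: cover K in sepK.
have cardA : #|cover K| + #|A| = #|G| by rewrite cardsC.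
have partA := components_partition A.
(* At most 5 components cover more than 5/6 of the vertices. *)
have [C CA bigC] : exists2 C, C \in components A & #|G| < 6 * #|C|.
  apply: contrapT => noC.
  suff : 6 * #|A| <= 5 * #|G| by lia.
  rewrite (card_partition partA) big_distrr /=.
  apply: (@leq_trans (\sum_(C in components A) #|G|)).
    apply: leq_sum => C CA; rewrite leqNgt; apply/negP => ltC.
    by apply: noC; exists C.
  by rewrite sum_nat_const leq_mul2r (leq_trans (card_components_le A)) ?orbT.
have sCA : C \subset A.
  by have [/eqP <- _ _] := and3P partA; apply: bigcup_sup CA.
have [S [sSC iS cardS]] : exists S : {set G}, [/\ S \subset C, independent S & #|S| = 3].
  by apply: independent_triple omega_w _; lia.
(* Here the balance of the separator enters: C has at most 4/6 of the vertices,
   out of more than 5/6. *)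
have [T [sTD iT cardT]] :
    exists T : {set G}, [/\ T \subset A :\: C, independent T & #|T| = 3].
  apply: independent_triple omega_w _.
  have := cardsD A C; rewrite (setIidPr sCA) => ->.
  have := sepK C CA; have := subset_leq_card sCA; lia.
have iST : independent (S :|: T).
  apply: independentU => // x y /(subsetP sSC) xC /(subsetP sTD) yD.
  exact: component_closed xC yD.
have := leq_trans (independent_card_alpha iST) alpha5.
rewrite cardsU cardS cardT; suff -> : S :&: T = set0 by rewrite cards0.
apply/setP => x; rewrite !inE; apply/andP => -[/(subsetP sSC) xC /(subsetP sTD)].
by rewrite inE xC.
Qed.

(** * Random graphs by counting *)

Lemma bin_le_expn n k : 'C(n, k) <= n ^ k.
Proof.
elim: n k => [|n IHn] [|k] //; rewrite binS.
apply: leq_trans (leq_add (IHn k.+1) (IHn k)) _.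
rewrite expnS -mulSnr expnS leq_mul2l; apply/orP; right.
by case: k => // k; rewrite leq_exp2r.
Qed.

(** In the form (1 - 1/q)^q <= 1/2, this is what makes large cliques
    exponentially unlikely; it is an instance of Bernoulli's inequality. *)
Lemma double_expn_pred q : 0 < q -> 2 * q.-1 ^ q <= q ^ q.
Proof.
case: q => // p _ /=.
have bern n : p ^ n * (p + n) <= p.+1 ^ n * p.
  elim: n => [|n IH]; first by rewrite !expn0 addn0.
  rewrite !expnS; move: IH; nia.
case: p bern => [|p] bern; first by rewrite exp0n.
have := bern p.+2; nia.
Qed.

(** A uniformly random colouring f satisfies P on all of E with probability
    (|P| / |T|)^|E|; the identity is cleared of denominators. *)
Lemma card_ffun_constrained (I T : finType) (E : {set I}) (P : pred T) :
  #|[set f : {ffun I -> T} | [forall e in E, P (f e)]]| * #|T| ^ #|E| =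
  #|P| ^ #|E| * #|{ffun I -> T}|.
Proof.
rewrite card_ffun.
pose F e : pred T := if e \in E then P else predT.
have -> : #|[set f : {ffun I -> T} | [forall e in E, P (f e)]]| = \prod_e #|F e|.
  transitivity #|family F|; last by rewrite card_family foldrE big_map big_enum.
  apply: eq_card => f; rewrite inE; apply/forall_inP/familyP => h e.
    by rewrite /F; case: ifP => [/h|].
  by move=> eE; have := h e; rewrite /F eE.
rewrite (bigID (mem E)) /= (eq_bigr (fun=> #|P|)); last by move=> e eE; rewrite /F eE.
rewrite (eq_bigr (fun=> #|T|) (P := fun e => e \notin E)); last first.
  by move=> e /negbTE eE; rewrite /F eE; apply: eq_card.
rewrite !prod_nat_const -mulnA -expnD; congr (_ * _ ^ _).
by rewrite addnC -(cardC E).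
Qed.

Definition pairs (V : finType) (U : {set V}) : {set {set V}} :=
  [set e : {set V} | (e \subset U) && (#|e| == 2)].

(** For P the colour of nonadjacency and for its complement, this is the
    existence of an independent set of size k, resp. a clique of size k, in the
    graph coded by f.  Colouring every subset of V, though only the pairs carry
    edges, makes the edge relation symmetric by construction. *)
Definition has_constrained_set (V T : finType) k (P : pred T) (f : {ffun {set V} -> T}) :=
  [exists U : {set V}, (#|U| == k) && [forall e in pairs U, P (f e)]].

(** Union bound: there are 'C(#|V|, k) candidate sets, each of which constrains
    'C(k, 2) pairs. *)
Lemma constrained_union_bound (V T : finType) k (P : pred T) :
  0 < #|T| -> 2 * ('C(#|V|, k) * #|P| ^ 'C(k, 2)) < #|T| ^ 'C(k, 2) ->
  2 * #|[set f : {ffun {set V} -> T} | has_constrained_set k P f]| <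
    #|{ffun {set V} -> T}|.
Proof.
move=> T_gt0 ltP; have Tk_gt0 : 0 < #|T| ^ 'C(k, 2) by rewrite expn_gt0 T_gt0.
pose B U := [set f : {ffun {set V} -> T} | [forall e in pairs U, P (f e)]].
set X := [set f | _].
have sXB : X \subset \bigcup_(U in [set U : {set V} | #|U| == k]) B U.
  apply/subsetP => f; rewrite inE => /existsP[U /andP[cardU fU]].
  by apply/bigcupP; exists U; rewrite inE.
have := leq_trans (subset_leq_card sXB) (leq_card_bigcup _ B).
rewrite -(leq_pmul2r Tk_gt0) big_distrl /=.
rewrite (eq_bigr (fun=> #|P| ^ 'C(k, 2) * #|{ffun {set V} -> T}|)); last first.
  move=> U; rewrite inE => /eqP cardU.
  by rewrite -[in LHS]cardU -cards_draws card_ffun_constrained cards_draws cardU.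
rewrite sum_nat_const card_draws => leX.
rewrite -(ltn_pmul2r Tk_gt0) -mulnA.
apply: (@leq_ltn_trans (2 * ('C(#|V|, k) * #|P| ^ 'C(k, 2)) * #|{ffun {set V} -> T}|)).
  by rewrite -mulnA leq_mul2l /= -mulnA.
by rewrite [ltnRHS]mulnC ltn_pmul2r // card_ffun expn_gt0 T_gt0.
Qed.

(** The last two hypotheses say that the expected numbers of independent k-sets and
    of m-cliques are both below 1/2 when nonadjacency has probability 1/q. *)
Lemma ramsey_graph n k m q :
  0 < n -> 0 < q -> 2 * 'C(n, k) < q ^ 'C(k, 2) ->
  2 * ('C(n, m) * q.-1 ^ 'C(m, 2)) < q ^ 'C(m, 2) ->
  exists G : sgraph, [/\ #|G| = n,
    forall S : {set G}, independent S -> #|S| != k &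
    forall Q : {set G}, clique Q -> #|Q| != m].
Proof.
move=> n_gt0 q_gt0 ltk ltm.
(* z is the colour that means nonadjacent. *)
pose V := 'I_n; pose T := 'I_q; pose z : T := Ordinal q_gt0.
have := @constrained_union_bound V T k (pred1 z).
rewrite card1 exp1n muln1 !card_ord => /(_ q_gt0 ltk).
have := @constrained_union_bound V T m (predC1 z).
rewrite cardC1 !card_ord => /(_ q_gt0 ltm).
set Y := [set f | _]; set X := [set f | _] => ltY ltX.
have /card_gt0P[f] : 0 < #|~: (X :|: Y)|.
  have cardXY : #|X :|: Y| + #|~: (X :|: Y)| = #|{ffun {set V} -> T}| by rewrite cardsC.
  rewrite -(ltn_add2l #|X :|: Y|) addn0 cardXY.
  have [leXY _] := leq_card_setU X Y; apply: leq_ltn_trans leXY _.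
  by rewrite -(ltn_pmul2l (m := 2)) // mulnDr [ltnRHS]mul2n -addnn -addSn leq_add // ltnW.
rewrite !inE negb_or => /andP[/existsPn noX /existsPn noY].
pose e (x y : V) := (x != y) && (f [set x; y] != z).
have e_sym : symmetric e by move=> x y; rewrite /e eq_sym setUC.
have e_irr : irreflexive e by move=> x; rewrite /e eqxx.
have V_gt0 : 0 < #|V| by rewrite card_ord.
exists (SGraph e_sym e_irr V_gt0); split; first by rewrite card_ord.
- move=> S /independentP iS; apply/negP => cardS.
  move: (noX S); rewrite cardS /= => /negP; apply; apply/forall_inP => u.
  rewrite inE => /andP[suS /cards2P[x [y [xy def_u]]]].
  move: suS; rewrite def_u subUset !sub1set => /andP[xS yS].
  by have := iS x y xS yS; rewrite /= /e xy negbK.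
- move=> S /cliqueP[_ cS]; apply/negP => cardS.
  move: (noY S); rewrite cardS /= => /negP; apply; apply/forall_inP => u.
  rewrite inE => /andP[suS /cards2P[x [y [xy def_u]]]].
  move: suS; rewrite def_u subUset !sub1set => /andP[xS yS].
  by have := cS x y xS yS xy; rewrite /= /e xy.
Qed.

(** The powers of 2 below arise from n = 2^(18 a), q = 2^(8 a) = n^(4/9): the
    exponent 4/9 lies between the 2/5 that independent 6-sets require and the
    1/2 that leaves room for cliques of size at most sqrt n / 8.  A set of
    w + 1 = 2 q v + 1 vertices has q v (w + 1) pairs, so it is a clique with
    probability at most 2^(- v (w + 1)), which beats the n^(w + 1) candidate
    sets once 2 n < 2^v. *)
Lemma ramsey_graph_sqrt N : exists w, exists G : sgraph,
  [/\ N < w, #|G| = 64 * w ^ 2, alpha [set: G] <= 5 &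
      forall Q : {set G}, clique Q -> #|Q| <= w].
Proof.
(* Starting at 12 makes 18 a + 1 < 2^(a - 4) hold, and the 4 turns w^2 into
   n / 64. *)
pose a := N + 12; pose q := 2 ^ (8 * a); pose v := 2 ^ (a - 4).
have ltv : 18 * a + 1 < v.
  rewrite /v /a -addnBA //; elim: (N) => // M.
  rewrite (addSn M 12) (addSn M (12 - 4)) expnS; move: (2 ^ _) => u; lia.
pose w := 2 * q * v.
have def_n : 64 * w ^ 2 = 2 ^ (18 * a).
  rewrite /w /q /v -[2 * _]expnS -expnD -expnM -(@expnD 2 6); congr (_ ^ _); lia.
have q_gt0 : 0 < q by rewrite expn_gt0.
have w_gt0 : 0 < w by rewrite !muln_gt0 q_gt0 expn_gt0.
have [] := @ramsey_graph (64 * w ^ 2) 6 w.+1 q.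
- by rewrite def_n expn_gt0.
- by [].
- apply: (@leq_ltn_trans (2 * (64 * w ^ 2) ^ 6)); first by rewrite leq_mul2l bin_le_expn.
  rewrite def_n /q -!expnM -expnS ltn_exp2l //; rewrite (_ : 'C(6, 2) = 15) //; lia.
- have -> : 'C(w.+1, 2) = q * (v * w.+1).
    rewrite bin2 -[RHS]doubleK -mul2n /=; congr _./2.
    by move: (w.+1) => x; rewrite /w; nia.
  set n := 64 * w ^ 2.
  apply: (@leq_ltn_trans ((2 * n) ^ w.+1 * q.-1 ^ (q * (v * w.+1)))).
    rewrite mulnA leq_mul2r; apply/orP; right; rewrite expnMn leq_mul ?bin_le_expn //.
    by rewrite expnS leq_pmulr ?expn_gt0.
  set E := v * w.+1.
  apply: (@leq_trans (2 ^ E * q.-1 ^ (q * E))); last first.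
    by rewrite !(expnM _ q) -expnMn leq_exp2r ?double_expn_pred // muln_gt0 expn_gt0.
  rewrite ltn_pmul2r; last first.
    by rewrite expn_gt0 -subn1 subn_gt0 (@ltn_exp2l 2 0) // muln_gt0 addn_gt0 orbT.
  by rewrite /n def_n -expnS -expnM ltn_exp2l // ltn_pmul2r // -addn1.
move=> G [cardG iG cG]; exists w, G; split=> //.
- move: ltv; rewrite /w /a; nia.
- apply/bigmax_leqP => S /andP[_ /independentP iS]; rewrite leqNgt; apply/negP => ltS.
  have [S' sS' cardS'] := subset_of_card ltS.
  suff /iG : independent S' by rewrite cardS'.
  by apply/independentP => x y /(subsetP sS') xS /(subsetP sS') yS; apply: iS.
- move=> Q /cliqueP[_ cQ]; rewrite leqNgt; apply/negP => ltQ.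
  have [Q' sQ' cardQ'] := subset_of_card ltQ.
  suff /cG : clique Q' by rewrite cardQ' eqxx.
  apply/cliqueP; split; first by rewrite -card_gt0 cardQ'.
  by move=> x y /(subsetP sQ') xQ /(subsetP sQ') yQ; apply: cQ.
Qed.

(** * The lower bound over the reals *)

Lemma sqrt_div_log2_le (R : realType) (n k : nat) :
  1 < n -> n <= k ^ 2 -> (Num.sqrt (n%:R / log2 n%:R) <= k%:R :> R)%R.
Proof.
move=> n_gt1 le_nk; have ln2_gt0 : (0 < ln (2%:R : R))%R by rewrite ln_gt0 // ltr1n.
have log_ge1 : (1 <= log2 (n%:R : R))%R.
  by rewrite /log2 ler_pdivlMr // mul1r ler_ln ?posrE ?ltr0n ?ler_nat // ltnW.
rewrite -[leRHS]ger0_norm // -sqrtr_sqr ler_wsqrtr //.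
rewrite ler_pdivrMr ?(lt_le_trans ltr01) // -natrX.
by apply: le_trans (_ : _ <= (k ^ 2)%:R)%R _; rewrite ?ler_nat ?ler_peMr.
Qed.

Theorem proposition5p4 (R : realType) :
  exists (C : sgraph -> Prop) (c : R),
    [/\ hereditary C,
        bounded_tree_independence_number C,
        (0 < c)%R
      & forall N : nat, exists n : nat, N <= n /\
          exists G : sgraph, [/\ C G, #|G| = n &
            forall K : {set {set G}}, clique_based_separator K ->
              (c * Num.sqrt (n%:R / log2 n%:R) <= #|K|%:R)%R]].
Proof.
exists (fun G : sgraph => alpha [set: G] <= 5), 1%R; split.
- exact: hereditary_alpha.
- by exists 5 => G; apply: leq_trans (tree_independence_number_le G).
- exact: Num.Theory.ltr01.
move=> N; have [w [G [ltw cardG aG cG]]] := ramsey_graph_sqrt N.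
exists (64 * w ^ 2); split; first nia.
exists G; split=> // K sepK; rewrite GRing.mul1r; apply: sqrt_div_log2_le; first nia.
have := clique_separator_lower_bound aG cG _ sepK; rewrite cardG.
nia.
Qed.
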